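(* For any ordinal $\lambda<\mathfrak c^+$ with $\mathrm{cf}(\lim\lambda)=\omega$, there exists a separable special FLS space of cardinality $\mathfrak c$ and scattered height $\lambda$.
   Context: $\mathfrak c$ is the cardinality of the continuum and $\mathfrak c^+$ its successor cardinal. Every ordinal $\lambda$ is uniquely $\lambda=\mu+n$ with $\mu$ a limit ordinal ($0$ counts as a limit ordinal) and $n\in\omega$; $\lim\lambda:=\mu$ is its limit part. $\mathrm{cf}$ denotes cofinality. Each ordinal is identified with the set of smaller ordinals. All spaces are Hausdorff topological spaces. For a space $X$, $X^{(1)}$ is the set of non-isolated points of $X$; $X^{(0)}=X$ and $X^{(\alpha)}=\bigcap_{\xi<\alpha}(X^{(\xi)})^{(1)}$ for ordinals $\alpha>0$. $X$ is scattered if every nonempty subspace of $X$ has an isolated point; the scattered height of a scattered space $X$ is the smallest ordinal $\alpha$ with $X^{(\alpha)}=\emptyset$. An FLS space is a first-countable Lindelöf scattered (Hausdorff) space. Scattered modifications: let $(X,\tau)$ be a nonempty topological space. A height function on $X$ is a surjective function $h:X\to h[X]$ onto an ordinal $h[X]$ such that for every $\alpha\in h[X]$ the set $h^{-1}\{\alpha\}$ is dense in $\{x\in X: h(x)\ge\alpha\}$. The scattered $h$-modification $X_h$ of $X$ is the set $X$ with the topology generated by the base of sets $B_h(x;U)=\{x\}\cup\{y\in U:h(y)<h(x)\}$, where $x\in U\in\tau$. A scattered space is special if it is homeomorphic to a scattered modification of some metrizable space. *)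

(* Defs.v *)
From HB Require Import structures.
From mathcomp Require Import all_boot all_order all_algebra.
From mathcomp Require Import all_classical all_reals all_analysis.
From mathcomp Require wochoice.

Set Implicit Arguments.
Unset Strict Implicit.
Unset Printing Implicit Defensive.

Import Order.TTheory.
Local Open Scope classical_set_scope.
Local Open Scope card_scope.
Local Open Scope order_scope.

(** Ordinals. An ordinal is represented by a well-ordered [orderType] (its set
    of smaller ordinals); if [K] is such a type, an element [k : K] stands for
    the smaller ordinal whose set of smaller ordinals is [below k]. *)

Section Ordinals.
Context {d : Order.disp_t} {K : orderType d}.
Implicit Types a b l m : K.

Definition below a : set K := [set x | x < a].

Definition is_succ a b := a < b /\ forall c, a < c -> b <= c.

(* 0, which has no predecessor, counts as a limit. *)
Definition is_limit m := forall a, ~ is_succ a m.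

(* [is_addn m n l]: l = m + n *)
Fixpoint is_addn m (n : nat) l : Prop :=
  if n is n'.+1 then exists2 a, is_addn m n' a & is_succ a l else l = m.

(* [limit_part l m]: m = lim l *)
Definition limit_part l m := is_limit m /\ exists n, is_addn m n l.

Definition cofinal_in m (C : set K) :=
  C `<=` below m /\ forall a, a < m -> exists2 c, C c & a <= c.

(* [cofinality m B]: cf(m) is the cardinality of B *)
Definition cofinality m (T : Type) (B : set T) :=
  (exists2 C, cofinal_in m C & C #= B) /\
  (forall C, cofinal_in m C -> B #<= C).

End Ordinals.

Definition well_ordered {d : Order.disp_t} (K : orderType d) : Prop :=
  well_founded (fun x y : K => x < y).

(* A well-ordered [K] satisfying this is the successor cardinal of the
   cardinality of [A], i.e. the least ordinal of cardinality greater than that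
   of [A]; so [k : K] ranges over the ordinals k < |A|^+. *)
Definition is_succ_cardinal {d : Order.disp_t} (K : orderType d)
    (T : Type) (A : set T) :=
  ~ ([set: K] #<= A) /\ forall k : K, below k #<= A.

(* Successor cardinals exist, so quantifying over them is not vacuous. *)
Lemma succ_cardinal_exists (T : pointedType) (d : Order.disp_t) :
  exists K : orderType d, well_ordered K /\ is_succ_cardinal K [set: T].
Proof.
have [r rwo] := wochoice.well_ordering_principle (set T).
have rch := wochoice.wo_chainW (wochoice.withinW rwo).
have rtot x y : r x y || r y x by exact: rch.
have rmin (A : set (set T)) : A !=set0 ->
    exists2 x, A x & forall y, A y -> r x y.
  case=> x Ax; have [|z [[Az zmin] _]] := rwo (mem A).
    by exists x; apply/mem_set.
  by exists z; [exact/set_mem|move=> y Ay; apply: zmin; exact/mem_set].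
have ranti x y : r x y -> r y x -> x = y.
  move=> xy yx; apply: (wochoice.wo_chain_antisymmetric (wochoice.withinW rwo)) => //.
  by rewrite xy yx.
have rtr x y z : r x y -> r y z -> r x z.
  move=> xy yz.
  have [w] := rmin [set x; y; z] (ex_intro _ x (or_introl (or_introl erefl))).
  move=> [[->|->]|->] m; first by apply: m; right.
    have yx : r y x by apply: m; left; left.
    by rewrite (ranti _ _ xy yx).
  have zy : r z y by apply: m; left; right.
  by rewrite -(ranti _ _ yz zy).
pose seg x : set (set T) := [set y | r y x /\ y != x].
pose D : set (set T) := [set x | seg x #<= [set: T]].
pose le := [rel x y : D | r (val x) (val y)].
have le_anti : antisymmetric le.
  by move=> x y /andP[xy yx]; apply: val_inj; exact: ranti.
have le_trans : transitive le by move=> y x z; exact: rtr.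
have le_total : total le by move=> x y; exact: rtot.
pose lt := [rel x y : D | (y != x) && le x y].
pose O := Order.isOrder.Build d D (le := le) (lt := lt)
  (fun _ _ => erefl) (fun _ _ => erefl) (fun _ _ => erefl)
  le_anti le_trans le_total.
pose K : orderType d := HB.pack (set_type D) (Choice.on (set_type D)) O.
exists K; split; last split.
- move=> x; apply: contrapT => nax.
  pose N : set (set T) := [set val y | y in [set y : K | ~ Acc (fun x y : K => x < y) y]].
  have [_ [y nay <-] ymin] : exists2 x, N x & forall y, N y -> r x y.
    by apply: rmin; exists (val x), x.
  apply: nay; constructor => z zy; apply: contrapT => naz.
  have yz : y <= z by apply: ymin; exists z.
  by have := lt_le_trans zy yz; rewrite ltxx.
- have DK : D #<= [set: K].
    have -> : D = [set val x | x in [set: K]].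
      apply/seteqP; split=> [x Dx|_ [x _ <-]]; last exact/set_mem/(valP x).
      by exists (SigSub (mem_set Dx)).
    exact: card_image_le.
  move=> KT; have DT := card_le_trans DK KT.
  have [DU|] := pselect (D = setT).
    move: DT; rewrite DU => /pcard_injP[f finj].
    pose E := [set t | exists2 A, f A = t & ~ A t].
    have [EE|nEE] := pselect (E (f E)).
      by case: (EE) => A /(finj _ _ (in_setT _) (in_setT _)) -> /(_ EE).
    by apply: (nEE); exists E.
  move=> nD; have : (~` D) !=set0.
    apply: contrapT => nx; apply: nD; apply/seteqP; split=> // x _.
    by apply: contrapT => nDx; apply: nx; exists x.
  case/rmin => x nDx xmin; apply: nDx.
  rewrite /D/=; apply: card_le_trans DT; apply: subset_card_le => y [yx yNx].
  apply: contrapT => nDy; move/eqP: yNx; apply; apply: ranti => //; exact: xmin.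
- move=> k; have kD : D (val k) by exact/set_mem/(valP k).
  apply: card_le_trans kD.
  rewrite -(card_le_eql (inj_card_eq (A := below k) (f := (val : K -> set T)) _)).
    apply: subset_card_le => _ [x + <-]; rewrite /below/= lt_neqAle => /andP[xk lexk].
    by split=> //; rewrite (inj_eq val_inj).
  by move=> x y _ _; exact: val_inj.
Qed.

Section Spaces.
Variable X : topologicalType.

Definition nonisolated (A : set X) : set X := A `\` isolated A.

Section Derivative.
Context {d : Order.disp_t} {K : orderType d} (wK : well_ordered K).

Definition cb_derivative : K -> set X :=
  Fix wK (fun=> set X) (fun a D =>
    [set x | forall b (ltba : b < a), nonisolated (D b ltba) x]).

Lemma cb_derivativeE (a : K) :
  cb_derivative a = \bigcap_(b in below a) nonisolated (cb_derivative b).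
Proof.
rewrite /cb_derivative Fix_eq.
  by apply/seteqP; split=> x /= H b ltba; exact: H.
move=> {}a f g fg; apply/seteqP; split=> x /= H b ltba.
  by rewrite -fg; exact: H.
by rewrite fg; exact: H.
Qed.

Definition scattered_height (l : K) :=
  cb_derivative l = set0 /\ forall a, cb_derivative a = set0 -> l <= a.

End Derivative.

Definition scattered := forall A : set X, A !=set0 -> isolated A !=set0.

Definition first_countable := forall x : X, exists B : set (set X),
  [/\ countable B, B `<=` nbhs x &
      forall U, nbhs x U -> exists2 V, B V & V `<=` U].

Definition lindelof := forall C : set (set X), C `<=` open ->
  \bigcup_(U in C) U = [set: X] ->
  exists C', [/\ C' `<=` C, countable C' & \bigcup_(U in C') U = [set: X]].

Definition separable := exists2 D : set X, countable D & dense D.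

Definition FLS :=
  [/\ hausdorff_space X, first_countable, lindelof & scattered].

End Spaces.

Definition homeomorphic (X Y : topologicalType) :=
  exists (f : X -> Y) (g : Y -> X),
    [/\ cancel f g, cancel g f, continuous f & continuous g].

(* A copy of the type [X], meant to carry the topology of X_h. *)
Definition hmodification (X : topologicalType) (d : Order.disp_t)
  (A : orderType d) (h : X -> A) : Type := X.

Section ScatteredModification.
Context {X : topologicalType} {d : Order.disp_t} {A : orderType d}.
Variable h : X -> A.

Definition height_function :=
  [/\ well_ordered A, range h = [set: A] &
      forall a, [set x | a <= h x] `<=` closure (h @^-1` [set a])].

Definition hball (x : X) (U : set X) : set X :=
  x |` [set y | U y /\ h y < h x].

Definition hbase : set (set X) :=
  [set B | exists x U, [/\ open U, U x & B = hball x U]].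

HB.instance Definition _ := Choice.copy (hmodification h) X.

Let hbase_cover : \bigcup_(B in hbase) B = [set: hmodification h].
Proof.
apply/seteqP; split=> // x _; exists (hball x setT); last by left.
by exists x, setT; split=> //; exact: openT.
Qed.

Let hbase_join (B C : set X) (t : hmodification h) :
  hbase B -> hbase C -> B t -> C t ->
  exists E, [/\ hbase E, E t & E `<=` B `&` C].
Proof.
move=> [x [U [oU Ux ->]]] [y [V [oV Vy ->]]] Bt Ct.
have sub z W : W z -> hball z W t ->
    forall s, W s /\ h s < h t -> hball z W s.
  move=> Wz [->|[_ tz]] s [Ws st]; right; split=> //; exact: lt_trans st tz.
have hW z W : W z -> hball z W t -> W t by move=> Wz [->|[]].
exists (hball t (U `&` V)); split; last 2 first.
- by left.
- move=> s [->|[[Us Vs] st]]; first by split.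
  by split; apply: (sub _ _ _ _ s).
exists t, (U `&` V); split=> //; first exact: openI.
by split; [exact: (hW x)|exact: (hW y)].
Qed.

HB.instance Definition _ := isBaseTopological.Build (hmodification h)
  (b := id) hbase_cover hbase_join.

End ScatteredModification.

Definition special (R : realType) (X : topologicalType) :=
  scattered X /\
  exists (M : metricType R) (d : Order.disp_t) (A : orderType d) (h : M -> A),
    [/\ [set: M] !=set0, height_function h & homeomorphic X (hmodification h)].

(* Main.v *)
Require Import Defs.
From HB Require Import structures.
From mathcomp Require Import all_boot all_order all_algebra lra.
From mathcomp Require Import all_classical all_reals all_analysis.

Import numFieldNormedType.Exports.
Import Order.TTheory.

Set Implicit Arguments.
Unset Strict Implicit.
Unset Printing Implicit Defensive.

Local Open Scope classical_set_scope.
Local Open Scope card_scope.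

(** The space is a scattered modification of the real line, for a height
    function h from R onto the ordinals below lambda.

    As soon as all fibres of h are dense in R, the points of height at least
    a form the derivative of order a, so the scattered height is lambda
    ([hmodification_scattered_height]). The modification refines the
    topology of R, hence is Hausdorff, and inherits countable local bases.
    It is separable when the fibre over 0, the set of isolated points, is
    countable.

    The remaining point is the Lindelof property. Let mu be the limit part
    of lambda and C a countable cofinal subset of mu. Suppose that every
    uncountable closed subset of R contains points of height at least a, for
    each a in C. Given a cover by basic sets, the open sets of R underlying
    those centred at height at least a have a union whose complement is
    closed and misses all points of such height, so is countable; countably
    many of them have the same union, since R is hereditarily Lindelof, and
    the corresponding basic sets cover all points of the union of height
    below a. Letting a range over C, countably many basic sets cover all
    points of height below mu but countably many ([hmodification_lindelof]).
    As lambda = mu + n, there are only finitely many levels from mu on, and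
    the points on these can be covered one by one if their fibres are
    countable.

    So h must have dense fibres, countable over 0 and over the levels from
    mu on, and meeting every uncountable closed set over the other levels.
    This is the construction of Bernstein sets ([bernstein_level_function]):
    there are at most continuum many closed sets and continuum many levels,
    every uncountable closed set has continuum many points
    ([uncountable_closed_card]), and so a transfinite recursion picks a
    different point for each requested pair of a closed set and a level
    ([injective_representatives]). Throughout, the continuum is the
    cardinality of the type [set nat]. *)

(** * Cardinality *)

Lemma countable_setU {T : Type} (A B : set T) :
  countable A -> countable B -> countable (A `|` B).
Proof.
move=> cA cB; rewrite -bigcup2E; apply: bigcup_countable => // -[|[|n]] _ //=.
Qed.

Lemma card_le_inj {T U : Type} (A : set T) (B : set U) (f : T -> U) :
  set_fun A B f -> {in A &, injective f} -> A #<= B.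
Proof.
move=> fAB finj; apply: (card_le_trans _ (subset_card_le (_ : f @` A `<=` B))).
  by rewrite (card_le_eqr (inj_card_eq finj)).
by move=> _ [x Ax <-]; exact: fAB.
Qed.

Lemma card_le_setTP {T U : Type} (B : set U) : [set: T] #<= B ->
  exists2 f : T -> U, forall x, B (f x) & injective f.
Proof.
move=> /card_leP[g].
exists (fun x => val (g (SigSub (mem_setT x)))) => [x|x y /val_inj].
  exact: set_valP.
by move=> /(inj (mem_setT _) (mem_setT _)) /(congr1 val).
Qed.

(** A pair of subsets of nat is coded by interleaving them. *)
Lemma card_setM_le {S T : Type} (A : set S) (B : set T) :
  A #<= [set: set nat] -> B #<= [set: set nat] -> A `*` B #<= [set: set nat].
Proof.
move=> /pcard_injP[f finj] /pcard_injP[g ginj].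
pose code (p : S * T) : set nat :=
  fun n => if odd n then g p.2 n./2 else f p.1 n./2.
apply: (card_le_inj (f := code)) => // -[s t] [s' t']; rewrite !inE /=.
move=> [/= As Bt] [/= As' Bt'] pq; congr pair.
- apply: finj; rewrite ?inE //; apply/funext => n.
  by have := congr1 (@^~ n.*2) pq; rewrite /code odd_double doubleK.
- apply: ginj; rewrite ?inE //; apply/funext => n.
  have := congr1 (@^~ n.*2.+1) pq.
  by rewrite /code /= odd_double /= uphalf_double.
Qed.

(** * Injective systems of representatives *)

(** This replaces the initial ordinal of T: well-order T; if some proper
    initial segment is as large as T, inject T into the least such one by f,
    otherwise let f be the identity. *)
Lemma well_order_small_segments (T : choiceType) :
  exists (r : rel T) (f : T -> T),
    [/\ well_founded r, forall x y, x != y -> r x y || r y x, injective f &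
      forall x, ~ ([set: T] #<= [set y | r y (f x)])].
Proof.
have [r0 rwo] := wochoice.well_ordering_principle T.
have rtot x y : r0 x y || r0 y x.
  exact: (wochoice.wo_chainW (wochoice.withinW rwo)).
have ranti x y : r0 x y -> r0 y x -> x = y.
  move=> xy yx.
  apply: (wochoice.wo_chain_antisymmetric (wochoice.withinW rwo)) => //.
  by rewrite xy yx.
have rmin (S : set T) : S !=set0 -> exists2 x, S x & forall y, S y -> r0 x y.
  case=> x Sx; have [|z [[Sz zmin] _]] := rwo (mem S).
    by exists x; apply/mem_set.
  by exists z; [exact/set_mem|move=> y Sy; apply: zmin; exact/mem_set].
pose r : rel T := fun x y => r0 x y && (x != y).
have rwf : well_founded r.
  move=> x; apply: contrapT => nx.
  have [|y ny ymin] := rmin [set y | ~ Acc r y]; first by exists x.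
  apply: ny; constructor => z /andP[zy zney]; apply: contrapT => /ymin yz.
  by move: zney; rewrite (ranti _ _ zy yz) eqxx.
have rtri x y : x != y -> r x y || r y x.
  by move=> xy; rewrite /r (eq_sym y) xy !andbT.
pose big := [set x | [set: T] #<= [set y | r y x]].
have [/rmin[x bx xmin]|nbig] := pselect (big !=set0).
  have [f fx finj] := card_le_setTP bx.
  exists r, f; split=> // y fy; have /andP[fyx fnex] := fx y.
  by move: fnex; rewrite (ranti _ _ fyx (xmin _ fy)) eqxx.
exists r, id; split=> // x xbig; apply: nbig; by exists x.
Qed.

(** Transfinite recursion along an order with few predecessors: at each step
    fewer points have been used than [F i] has, so a fresh one is left. *)
Lemma injective_representatives (I : Type) (T : choiceType) (U : pointedType)
    (F : I -> set U) :
  [set: I] #<= [set: T] -> (forall i, [set: T] #<= F i) ->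
  exists2 x : I -> U, injective x & forall i, F i (x i).
Proof.
move=> /card_le_setTP[g _ ginj] TF.
have [r [f [rwf rtri finj small]]] := well_order_small_segments T.
pose k i := f (g i).
have kinj : injective k by move=> i j /finj /ginj.
pose s i j := r (k i) (k j).
have swf : well_founded s.
  move=> i; have [a ak] : exists a, k i = a by exists (k i).
  elim/(well_founded_ind rwf): a i ak => a IH i ak.
  by constructor => j sji; apply: (IH (k j)) => //; rewrite -ak.
pose step i (rec : forall j, s j i -> U) : U :=
  get (F i `\` [set u | exists j (ji : s j i), rec j ji = u]).
pose x := Fix swf (fun=> U) step.
have xE i : x i = get (F i `\` [set x j | j in [set j | s j i]]).
  rewrite /x Fix_eq => [|j p q pq]; rewrite /step; congr (get (_ `\` _)).
    by apply/seteqP; split=> u /= [j]; [move=> [ji <-]|move=> ji <-]; exists j.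
  by apply/seteqP; split=> u /= [l [lj <-]]; exists l, lj; rewrite pq.
have xP i : (F i `\` [set x j | j in [set j | s j i]]) (x i).
  rewrite xE; apply: getPex; apply: contrapT => none.
  apply: (small (g i)); apply: card_le_trans (TF i) _.
  have Fsub : F i `<=` [set x j | j in [set j | s j i]].
    by move=> u Fu; apply: contrapT => nu; apply: none; exists u.
  apply: card_le_trans (subset_card_le Fsub) _.
  apply: card_le_trans (card_image_le _ _) _.
  by apply: (card_le_inj (f := k)) => // ? ? _ _; exact: kinj.
exists x => [i j xij|i]; last by case: (xP i).
apply: contrapT => ij.
have /orP[sij|sji] : s i j || s j i.
  by apply: rtri; apply/eqP => /kinj.
- by case: (xP j) => _; apply; exists i.
- by case: (xP i) => _; apply; exists j.
Qed.

(** * Well-ordered sets *)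

Lemma well_ordered_min {d : Order.disp_t} (K : orderType d) (S : set K) :
  well_ordered K -> S !=set0 -> exists2 a, S a & forall b, S b -> (a <= b)%O.
Proof.
move=> wK [a Sa]; apply: contrapT => nmin.
elim/(well_founded_ind wK): a Sa => a IH Sa; apply: nmin.
exists a => // b Sb; rewrite leNgt; apply/negP => /IH; exact.
Qed.

Lemma countable_addn_levels {d : Order.disp_t} (K : orderType d) (m l : K) n :
  is_addn m n l -> (m <= l)%O /\ countable [set a | (m <= a < l)%O].
Proof.
elim: n l => [|n IH] l /=.
  move=> ->; split=> //.
  suff -> : [set a | (m <= a < m)%O] = set0 by exact: countable0.
  by apply/seteqP; split=> // a /=; rewrite le_lt_asym.
move=> [a /IH[ma cma] [al asucc]]; split.
  exact: le_trans ma (ltW al).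
apply: sub_countable (countable_setU cma (countable1 a)).
apply: subset_card_le => b /= /andP[mb bl].
have [ab|ba|->] := ltgtP a b; [|by left; rewrite mb|by right].
by have := asucc _ ab; rewrite leNgt bl.
Qed.

Definition initial_segment {d : Order.disp_t} {K : orderType d} (l : K) :
  Type := {x : K | (x < l)%O}.
HB.instance Definition _ {d} {K : orderType d} (l : K) :=
  SubType.on (initial_segment l).
HB.instance Definition _ {d} {K : orderType d} (l : K) :=
  [Choice of initial_segment l by <:].
HB.instance Definition _ {d} {K : orderType d} (l : K) :=
  [SubChoice_isSubOrder of initial_segment l by <: with d].

(** * Scattered modifications *)

(** Every basic open set inside some U i picks one such i; countably many
    picks suffice because each point of the union lies in such a basic set. *)
Lemma second_countable_hereditarily_lindelof {M : topologicalType}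
    {I : choiceType} (A : set I) (U : I -> set M) :
  @second_countable M -> (forall i, A i -> open (U i)) ->
  exists J, [/\ J `<=` A, countable J &
    \bigcup_(i in A) U i `<=` \bigcup_(i in J) U i].
Proof.
move=> [B cB [_ Bnbhs]] oU.
have [->|/set0P[i0 _]] := eqVneq A set0; first by exists set0; split.
pose S V := [set i | A i /\ V `<=` U i].
pose good V := B V /\ S V !=set0.
pose c V := xget i0 (S V).
have cP V : good V -> S V (c V) by move=> [_ /cid[i Si]]; exact: xgetI Si.
exists (c @` good); split.
- by move=> _ [V /cP[Ac _] <-].
- apply: sub_countable (card_image_le _ _) _.
  by apply: sub_countable cB; apply: subset_card_le => V [].
- move=> x [i Ai Uix].
  have [V [BV Vx] VU] := Bnbhs x _ (open_nbhs_nbhs (conj (oU i Ai) Uix)).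
  have gV : good V by split=> //; exists i.
  by exists (c V); [exists V | case: (cP _ gV) => _; apply].
Qed.

Section Modification.
Local Open Scope order_scope.
Context {M : topologicalType} {d : Order.disp_t} {A : orderType d}.
Variable h : M -> A.
Notation X := (hmodification h).

(** A basic open set around another centre contains one centred at x over the
    same open set of M, so the sets [hball h x U] form a base at x. *)
Lemma nbhs_hmodification (x : X) (V : set X) :
  nbhs x V <-> exists U, [/\ @open M U, U x & hball h x U `<=` V].
Proof.
split=> [|[U [oU Ux UV]]].
  rewrite nbhsE => -[_ [[D Dbase <-] [B DB Bx]] BV].
  have [z [W [oW Wz Beq]]] := Dbase _ DB.
  rewrite /= Beq in Bx BV.
  have WB : hball h x W `<=` hball h z W.
    move=> y [->//|[Wy yx]]; case: Bx => [<-|[_ xz]]; first by right.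
    by right; split=> //; exact: lt_trans yx xz.
  exists W; split=> //; first by case: Bx => [->|[]].
  by move=> y /WB yB; apply: BV; exists B => //=; rewrite Beq.
rewrite nbhsE; exists (hball h x U) => //; split; last by left.
exists [set hball h x U]; first by move=> _ ->; exists x, U.
by rewrite bigcup_set1.
Qed.

Lemma nbhs_hball (x : X) (U : set M) :
  @open M U -> U x -> nbhs x (hball h x U).
Proof. by move=> oU Ux; apply/nbhs_hmodification; exists U; split. Qed.

Lemma nbhs_hmodificationW (x : X) (U : set M) : @nbhs M M x U -> @nbhs X X x U.
Proof.
rewrite nbhsE => -[V [oV Vx] VU].
apply/nbhs_hmodification; exists V; split=> //.
by apply: subset_trans VU => y [->|[]].
Qed.

Lemma hmodification_hausdorff : hausdorff_space M -> hausdorff_space X.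
Proof.
move=> hM p q pq; apply: hM => U V pU qV.
by apply: pq; exact: nbhs_hmodificationW.
Qed.

Lemma hmodification_first_countable : @second_countable M -> first_countable X.
Proof.
move=> [B cB [Bo Bnbhs]] x.
exists (hball h x @` (B `&` [set U | U x])); split.
- apply: sub_countable (card_image_le _ _) _.
  by apply: sub_countable cB; apply: subset_card_le => U [].
- by move=> _ [U [BU Ux] <-]; apply: nbhs_hball Ux; exact: Bo.
- move=> V /nbhs_hmodification[U [oU Ux UV]].
  have [W [BW Wx] WU] := Bnbhs x _ (open_nbhs_nbhs (conj oU Ux)).
  exists (hball h x W); first by exists W.
  by apply: subset_trans UV => y [->|[/WU]]; [left|right].
Qed.

(** A point of least height in S is isolated in S: its basic neighbourhoods
    contain, apart from itself, only points of smaller height. *)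
Lemma hmodification_scattered : well_ordered A -> scattered X.
Proof.
move=> wA S [x0 Sx0].
have [_ [x Sx <-] xmin] :
    exists2 a, (h @` S) a & forall b, (h @` S) b -> a <= b.
  by apply: well_ordered_min wA _; exists (h x0), x0.
exists x; split; first exact/mem_set.
exists (hball h x setT); first by apply: nbhs_hball => //; exact: openT.
apply/seteqP; split=> [y [[->//|[_ yx]] Sy]|_ ->]; last by split=> //; left.
by have := le_lt_trans (xmin (h y) (ex_intro2 _ _ y Sy erefl)) yx; rewrite ltxx.
Qed.

Section DenseFibres.
Hypothesis dense_fibre :
  forall a (U : set M), open U -> U !=set0 -> exists2 x, U x & h x = a.

Lemma dense_fibres_height_function : well_ordered A ->
  [set: M] !=set0 -> height_function h.
Proof.
move=> wA M0; split=> //.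
  apply/seteqP; split=> // a _.
  by have [x _ <-] := dense_fibre a openT M0; exists x.
move=> a x _ U; rewrite nbhsE => -[V [oV Vx] VU].
have [|y Vy hy] := dense_fibre a oV; first by exists x.
by exists y; split=> //; exact: VU.
Qed.

(** A point of height a is alone in its basic neighbourhoods intersected with
    the set of points of height at least a. A higher point keeps, in each of
    its neighbourhoods, points of height a, since these are dense in M. *)
Lemma hmodification_nonisolated a :
  nonisolated [set x : X | a <= h x] = [set x : X | a < h x].
Proof.
apply/seteqP; split=> x /=.
  move=> [ax nix]; rewrite lt_neqAle ax andbT; apply/eqP => axE; apply: nix.
  split; first exact/mem_set.
  exists (hball h x setT); first by apply: nbhs_hball => //; exact: openT.
  apply/seteqP; split=> [y [[->//|[_ yx]] /= ay]|_ ->].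
    2: by split=> //; left.
  by have := le_lt_trans ay yx; rewrite axE ltxx.
move=> ax; split; first exact: ltW.
move=> [_ [V /nbhs_hmodification[U [oU Ux UV]] VE]].
have [|y Uy hy] := dense_fibre a oU; first by exists x.
suff yx : y = x by move: ax; rewrite -yx hy ltxx.
move/seteqP: VE => [VE _]; apply: VE; split=> /=; last by rewrite hy.
by apply: UV; right; split=> //; rewrite hy.
Qed.

(** The derivative of order a is the set of points of height at least a, where
    heights are read in the ordinals K through e. *)
Lemma hmodification_scattered_height {d' : Order.disp_t} {K : orderType d'}
    (wK : well_ordered K) (l : K) (e : A -> K) :
  {mono e : a b / a <= b} -> range e = below l -> [set: M] !=set0 ->
  scattered_height X wK l.
Proof.
move=> emono erange M0.
have eltl a : e a < l by have : below l (e a) by rewrite -erange; exists a.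
(* beyond the last level both sides are empty *)
have nonisoE a : nonisolated [set x : X | a <= e (h x)] =
    [set x : X | a < e (h x)].
  have [al|la] := ltP a l.
    have [b _ <-] : (range e) a by rewrite erange.
    rewrite -[LHS]/(nonisolated [set x : X | e b <= e (h x)]).
    have -> : [set x : X | e b <= e (h x)] = [set x : X | b <= h x].
      by apply/seteqP; split=> x /=; rewrite emono.
    rewrite hmodification_nonisolated.
    by apply/seteqP; split=> x /=; rewrite (leW_mono emono).
  have empty (x : X) : ~ a <= e (h x).
    by rewrite leNgt (lt_le_trans (eltl _) la).
  by apply/seteqP; split=> x => [[/empty]|/ltW/empty].
have cbE a : @cb_derivative X _ K wK a = [set x : X | a <= e (h x)].
  elim/(well_founded_ind wK): a => a IH; rewrite cb_derivativeE.
  apply/seteqP; split=> x /= => [H|ax b ba].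
    rewrite leNgt; apply/negP => xa.
    by have := H _ xa; rewrite IH // nonisoE /= ltxx.
  by rewrite IH // nonisoE /=; exact: lt_le_trans ba ax.
split.
  rewrite cbE; apply/seteqP; split=> x //=.
  by rewrite leNgt eltl.
move=> a; rewrite cbE => aE; rewrite leNgt; apply/negP => al.
have [b _ bE] : (range e) a by rewrite erange.
have [x _ hx] := dense_fibre b openT M0.
by have : (set0 : set X) x by rewrite -aE /= hx bE.
Qed.

Lemma hmodification_separable a : (forall b, a <= b) ->
  countable (h @^-1` [set a]) -> separable X.
Proof.
move=> amin ca; exists (h @^-1` [set a]) => // O [x Ox] oO.
have /nbhs_hmodification[U [oU Ux UO]] : nbhs x O by exact: open_nbhs_nbhs.
have [hx|hx] := eqVneq (h x) a; first by exists x.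
have [|y Uy hy] := dense_fibre a oU; first by exists x.
exists y; split=> //; apply: UO; right; split=> //.
by rewrite hy lt_neqAle eq_sym hx amin.
Qed.
End DenseFibres.

(** Let each x choose an open set [U x] of M such that [hball h x (U x)] lies in
    a member of the cover. For a level a in C, the union of the [U x] with
    a <= h x is open in M and contains every point of height at least a, so by
    assumption it misses only countably many points; and countably many of
    these [U x] have the same union. A point y of height below a in this union
    is in [U x] for a chosen x, and h y < a <= h x puts it in [hball h x (U x)].
    Only countably many points remain: those missed for some a in C, and those
    whose height is at least every a in C. *)
Lemma hmodification_lindelof (C : set A) : @second_countable M ->
  countable C ->
  (forall a (F : set M), C a -> closed F ->
    (forall x, F x -> h x < a) -> countable F) ->
  countable [set x | forall a, C a -> a <= h x] ->
  lindelof X.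
Proof.
move=> scM cC big ctop O Oo Ocov.
have nb (x : X) : exists GU : set X * set M,
    [/\ O GU.1, open GU.2, GU.2 x & hball h x GU.2 `<=` GU.1].
  have [G OG Gx] : (\bigcup_(V in O) V) x by rewrite Ocov.
  have /nbhs_hmodification[U [oU Ux UG]] : nbhs x G.
    by apply: open_nbhs_nbhs; split=> //; exact: Oo.
  by exists (G, U).
have {nb} [f fP] := choice nb.
pose G x := (f x).1; pose U x := (f x).2.
have oU x : open (U x) by case: (fP x).
have Ux x : U x x by case: (fP x).
have hJ (a : A) : exists J : set M, [/\ J `<=` [set x | a <= h x], countable J &
    \bigcup_(x in [set x | a <= h x]) U x `<=` \bigcup_(x in J) U x].
  exact: second_countable_hereditarily_lindelof.
have {hJ} [J JP] := choice hJ.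
pose F a := ~` \bigcup_(x in [set x | a <= h x]) U x.
have cF a : C a -> countable (F a).
  move=> Ca; apply: (big a) => //.
    by rewrite closedC; apply: bigcup_open => x _; exact: oU.
  by move=> x Fx; rewrite ltNge; apply/negP => ax; apply: Fx; exists x.
pose D := [set x | forall a, C a -> a <= h x] `|`
  \bigcup_(a in C) (J a `|` F a).
exists (G @` D); split.
- by move=> _ [x _ <-]; case: (fP x).
- apply: sub_countable (card_image_le _ _) _.
  apply: countable_setU => //; apply: bigcup_countable => // a Ca.
  by apply: countable_setU; [case: (JP a)|exact: cF].
- apply/seteqP; split=> // x _.
  have self y : D y -> (\bigcup_(V in G @` D) V) y.
    move=> Dy; exists (G y); first by exists y.
    by case: (fP y) => _ _ _; apply; left.
  have [xtop|/existsNP[a /not_implyP[Ca /negP]]] :=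
    pselect (forall a, C a -> a <= h x); first by apply: self; left.
  rewrite -ltNge => xa.
  have [|Fx] := pselect ((\bigcup_(y in [set y | a <= h y]) U y) x); last first.
    by apply: self; right; exists a => //; right.
  have [Ja _ /[apply]] := JP a; move=> [y Jy Uyx].
  exists (G y); first by exists y => //; right; exists a => //; left.
  case: (fP y) => _ _ _; apply; right; split=> //.
  exact: lt_le_trans xa (Ja _ Jy).
Qed.
End Modification.

(** * Uncountable closed sets of reals *)

Section Reals.
Import GRing.Theory Num.Theory.
Local Open Scope ring_scope.
Variable R : realType.
Implicit Types K F : set R.

Definition rat_itv (p : rat * rat) : set R := `]ratr p.1, ratr p.2[.

Lemma rat_itv_nbhs (x : R) (U : set R) : nbhs x U ->
  exists p, [/\ p.1 < p.2, rat_itv p x & rat_itv p `<=` U].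
Proof.
move=> /nbhs_ballP[e /= e0 eU].
have [|p] := @rat_in_itvoo R (x - e) x; first lra.
have [|q] := @rat_in_itvoo R x (x + e); first lra.
rewrite !in_itv/= => /andP[xq qe] /andP[pe px].
exists (p, q); split => /=.
- by rewrite -(ltr_rat R); exact: lt_trans px xq.
- by rewrite /rat_itv /= in_itv /= px xq.
- move=> y; rewrite /rat_itv /= in_itv /= => /andP[py yq].
  by apply: eU; rewrite -ball_normE /= ltr_norml; apply/andP; split; lra.
Qed.

Lemma second_countable_real : @second_countable R.
Proof.
exists (range rat_itv).
  apply: sub_countable (card_image_le _ _) _; exact: countableP.
split=> [_ [p _ <-]|x U /rat_itv_nbhs[p [_ px pU]]]; first exact: interval_open.
by exists (rat_itv p) => //; split=> //; exists p.
Qed.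

Lemma uncountable_itv (a b : R) : a < b -> ~ countable `[a, b].
Proof.
move=> ab /countable_lebesgue_measure0.
rewrite lebesgue_measure_itv /= lte_fin ab -EFinB => -[]; lra.
Qed.

(** By the Lindelof property, all but countably many points of K are
    condensation points (all their neighbourhoods meet K in an uncountable
    set). Any two of these have neighbourhoods inside two disjoint closed
    rays. *)
Lemma uncountable_split K : ~ countable K ->
  exists p q, [/\ p < q, ~ countable (K `&` `]-oo, p]) &
    ~ countable (K `&` `[q, +oo[)].
Proof.
move=> uK.
pose A := [set U : set R | open U /\ countable (K `&` U)].
have cN : countable (K `&` \bigcup_(U in A) U).
  have [|J [JA cJ AJ]] := @second_countable_hereditarily_lindelof R (set R) A id
    second_countable_real; first by move=> U [].
  apply: (@sub_countable _ _ _ (\bigcup_(U in J) (K `&` U))).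
    by apply: subset_card_le => x [Kx /AJ[U JU Ux]]; exists U.
  by apply: bigcup_countable => // U /JA[].
have condense x (U : set R) : ~ (\bigcup_(U in A) U) x -> open U -> U x ->
    ~ countable (K `&` U).
  by move=> xA oU Ux cU; apply: xA; exists U.
have pick (N : set R) : countable N -> exists x, K x /\ ~ N x.
  move=> cN'; apply: contrapT => nx; apply: uK; apply: sub_countable cN'.
  apply: subset_card_le => x Kx; apply: contrapT => Nx; apply: nx; by exists x.
have [x [Kx /not_andP[//|xA]]] := pick _ cN.
have [y [Ky /not_orP[/not_andP[//|yA] yx]]] :=
  pick _ (countable_setU cN (countable1 x)).
have uncS (N N' : set R) : N `<=` N' -> ~ countable N -> ~ countable N'.
  move=> NN' uN cN'; apply: uN; apply: sub_countable cN'.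
  exact: subset_card_le.
have main (u v : R) : ~ (\bigcup_(U in A) U) u -> ~ (\bigcup_(U in A) U) v ->
    u < v -> exists p q, [/\ p < q, ~ countable (K `&` `]-oo, p]) &
    ~ countable (K `&` `[q, +oo[)].
  move=> uA vA uv; exists ((2 * u + v) / 3), ((u + 2 * v) / 3).
  split; first lra.
  - apply: (uncS _ _ _ (condense u `]-oo, ((2 * u + v) / 3)[%classic uA _ _)).
    + move=> z [Kz]; rewrite /= in_itv /= => zl; split=> //.
      by rewrite /= in_itv /= ltW.
    + exact: interval_open.
    + by rewrite /= in_itv /=; lra.
  - apply: (uncS _ _ _ (condense v `]((u + 2 * v) / 3), +oo[%classic vA _ _)).
    + move=> z [Kz]; rewrite /= in_itv /= andbT => zl; split=> //.
      by rewrite /= in_itv /= andbT ltW.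
    + exact: interval_open.
    + by rewrite /= in_itv /= andbT; lra.
have xy : x != y by apply/eqP => xy; exact: yx.
case/orP: (lt_total xy); [exact: (main _ _ xA yA)|exact: (main _ _ yA xA)].
Qed.

(** Cantor scheme: splitting K again and again gives for each set b of
    naturals a decreasing sequence of compact sets. Compactness provides a
    point in the intersection, and the points of two sets b and b' differ
    because the sequences become disjoint at the first number telling b from
    b'. *)
Lemma uncountable_compact_card K : compact K -> ~ countable K ->
  [set: set nat] #<= K.
Proof.
move=> cK uK.
pose good (L : set R) := compact L /\ ~ countable L.
have /choice[f fP] (L : set R) : exists g : bool -> set R, good L ->
    [/\ forall b, good (g b), forall b, g b `<=` L &
        forall x, g true x -> g false x -> False].
  have [[cL uL]|] := pselect (good L); last by exists (fun=> L).
  have [p [q [pq up uq]]] := uncountable_split uL.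
  exists (fun b : bool => L `&` [set` if b then `]-oo, p] else `[q, +oo[]) => _.
  split.
  - move=> b; split; last by case: b.
    by apply: compact_closedI => //; case: b; exact: interval_closed.
  - by move=> b x [].
  - by move=> x [_ /=]; rewrite in_itv /= => xp [_ /=]; rewrite in_itv /=; lra.
pose S (b : set nat) := fix S n :=
  if n is n'.+1 then f (S n') `[< b n' >] else K.
have goodS b n : good (S b n).
  by elim: n => [//|n IH]; rewrite /=; case: (fP _ IH).
have SS b n m : (n <= m)%N -> S b m `<=` S b n.
  move=> /subnK<-; elim: (m - n)%N => [//|j IH]; rewrite addSn /=.
  by apply: subset_trans IH; case: (fP _ (goodS b (j + n)%N)).
have Sne b : \bigcap_n S b n !=set0.
  have := cK; rewrite compact_In0; apply.
    exists (S b) => n _; last first.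
      by rewrite setIC; apply/esym/setIidl; exact: (SS b 0%N).
    by apply: compact_closed; [exact: Rhausdorff|case: (goodS b n)].
  move=> D _; pose m := (\max_(i <- finmap.enum_fset D) i)%N.
  have [x Sx] : S b m !=set0.
    apply: contrapT => e; case: (goodS b m) => _; apply.
    suff -> : S b m = set0 by exact: countable0.
    by apply/seteqP; split=> x // Sx; apply: e; exists x.
  exists x => i /= iD; apply: (SS b i m) => //.
  exact: leq_bigmax_seq.
have /choice[x xP] := Sne.
apply: (card_le_inj (f := x)) => [b _|b b' _ _ bb']; first exact: (xP b 0%N).
apply: contrapT => neq.
have ex : exists n, `[< b n >] != `[< b' n >].
  apply: contrapT => none; apply: neq; apply/seteqP.
  split=> n bn; apply: contrapT => bn'; apply: none; exists n;
    by rewrite (asboolT bn) (asboolF bn').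
pose n := ex_minn ex.
(* before n the two branches made the same choices *)
have Sn : S b n = S b' n.
  rewrite /n; case: ex_minnP => m _ mmin {n}.
  have : (m <= m)%N by [].
  elim: {1 3 4}m => [//|l IH] lm /=; rewrite IH 1?ltnW //.
  congr (f _ _); apply/eqP; apply: contraLR lm => /mmin.
  by rewrite -leqNgt.
have nb : `[< b n >] != `[< b' n >] by rewrite /n; case: ex_minnP.
have := xP b n.+1 I; have := xP b' n.+1 I; rewrite /= Sn bb'.
have [_ _ disj] := fP _ (goodS b' n).
by move: nb; case: `[< b n >]; case: `[< b' n >] => // _ h1 h2;
  first [exact: disj h1 h2|exact: disj h2 h1].
Qed.

Lemma uncountable_closed_card F : closed F -> ~ countable F ->
  [set: set nat] #<= F.
Proof.
move=> cF uF.
have [n un] : exists n : nat, ~ countable (F `&` `[- n%:R, n%:R]).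
  apply: contrapT => /forallNP/= cn; apply: uF.
  apply: (@sub_countable _ _ _ (\bigcup_n (F `&` `[- n%:R, n%:R]))).
    apply: subset_card_le => x Fx.
    exists (Num.truncn `|x|).+1 => //; split=> //=.
    by rewrite in_itv /= -ler_norml ltW // truncnS_gt.
  by apply: bigcup_countable => // n _; exact: contrapT (cn n).
apply: card_le_trans (subset_card_le (@subIsetl _ F `[- n%:R, n%:R]%classic)).
apply: uncountable_compact_card => //; rewrite setIC.
by apply: compact_closedI => //; exact: segment_compact.
Qed.

(** A closed set is determined by the rational intervals that avoid it. *)
Lemma card_closed_le : [set F : set R | closed F] #<= [set: set nat].
Proof.
have [e _ einj] :
    exists2 e : rat * rat -> nat, forall p, setT (e p) & injective e.
  exact/card_le_setTP/countableP.
pose code F : set nat := [set e p | p in [set p | rat_itv p `<=` ~` F]].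
have codeE F G : closed F -> code F = code G -> G `<=` F.
  move=> cF FG x Gx; apply: contrapT => nFx.
  have /rat_itv_nbhs[p [_ px pF]] : nbhs x (~` F).
    by apply: open_nbhs_nbhs; split=> //; exact: closed_openC.
  have : code G (e p) by rewrite -FG; exists p.
  by case=> q qG /einj qp; apply: (qG x) => //; rewrite qp.
apply: (card_le_inj (f := code)) => // F G; rewrite !inE => cF cG FG.
by apply/seteqP; split; apply: codeE.
Qed.

Lemma card_real_le : [set: R] #<= [set: set nat].
Proof.
apply: card_le_trans card_closed_le; apply: (card_le_inj (f := set1)).
  move=> x _ /=; apply: accessible_closed_set1.
  by apply: hausdorff_accessible; exact: Rhausdorff.
by move=> x y _ _ xy; have : [set x] x by []; rewrite xy.
Qed.

End Reals.

(** * The level function *)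

Section LevelFunction.
Import GRing.Theory Num.Theory.
Local Open Scope ring_scope.
Variable R : realType.

Definition rat_segment (p : rat * rat) : set R := `[ratr p.1, ratr p.2].

(** A decomposition of the line into dense fibres, countable over S and of
    Bernstein type elsewhere. The requests (F, a), asking for a point of height
    a in F, are at most continuum many, and each F has continuum many points; so
    all can be answered by distinct points. For a in S only the segments with
    rational endpoints occur as F: these are enough for density, and they keep
    the fibre countable. Points that answer no request get a0, which lies
    outside S, so that they do not spoil this. *)
Lemma bernstein_level_function (L : Type) (S : set L) (a0 : L) :
  [set: L] #<= [set: set nat] -> countable S -> ~ S a0 ->
  exists h : R -> L, [/\ countable (h @^-1` S),
    forall a (U : set R), open U -> U !=set0 -> exists2 x, U x & h x = a &
    forall a (F : set R), ~ S a -> closed F -> ~ countable F ->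
      exists2 x, F x & h x = a].
Proof.
move=> cL cS Sa0.
pose good (p : set R * L) := [/\ closed p.1, ~ countable p.1 &
  S p.2 -> range rat_segment p.1].
pose I := {p | good p}.
pose F (i : I) := (sval i).1; pose level (i : I) := (sval i).2.
have svalinj : injective (sval : I -> set R * L).
  by move=> [p gp] [q gq] /= pq; exact: eq_exist.
have cI : [set: I] #<= [set: set nat].
  apply: card_le_trans (card_setM_le (card_closed_le R) cL).
  apply: (card_le_inj (f := sval)) => [[p []] //|i j _ _]; exact: svalinj.
have cF i : [set: set nat] #<= F i.
  by case: i => p [cp up ?]; exact: uncountable_closed_card.
have [x xinj xF] := injective_representatives cI cF.
have /choice[h hP] (y : R) : exists a,
    (exists2 i, x i = y & level i = a) \/ (~ (exists i, x i = y) /\ a = a0).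
  have [[i iy]|none] := pselect (exists i, x i = y).
    by exists (level i); left; exists i.
  by exists a0; right.
have hx i : h (x i) = level i.
  by case: (hP (x i)) => [[j /xinj-> ->]//|[[]]]; exists i.
have sel a G : good (G, a) -> exists2 y, G y & h y = a.
  move=> gG; exists (x (exist _ _ gG)); last by rewrite hx.
  exact: (xF (exist _ _ gG)).
exists h; split.
- apply: (@sub_countable _ _ _ (x @` [set i | S (level i)])).
    apply: subset_card_le => y /= Shy.
    case: (hP y) => [[i xi li]|[_ hy]]; first by exists i; rewrite //= li.
    by case: Sa0; rewrite -hy.
  apply: sub_countable (card_image_le _ _) _.
  apply: (@sub_countable _ _ _ (range rat_segment `*` S)).
    apply: (card_le_inj (f := sval)); last by move=> i j _ _; exact: svalinj.
    move=> [[G a] [cG uG iG]] /= Sa.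
    split; [exact: (iG Sa)|exact: Sa].
  apply: countableX => //.
  by apply: sub_countable (card_image_le _ _) _; exact: countableP.
- move=> a U oU [y Uy].
  have [[p q] [pq py pU]] := rat_itv_nbhs (open_nbhs_nbhs (conj oU Uy)).
  move: pq pU => /= pq pU.
  (* a closed rational segment inside the open rational interval *)
  pose r := ((2 * p + q) / 3); pose s := ((p + 2 * q) / 3).
  have pr : p < r by rewrite /r; lra.
  have rs : r < s by rewrite /r /s; lra.
  have sq : s < q by rewrite /s; lra.
  have [|z rz hz] := @sel a (rat_segment (r, s)).
    split=> /=; first exact: interval_closed.
      by apply: uncountable_itv; rewrite ltr_rat.
    by exists (r, s).
  exists z => //; apply: pU; move: rz.
  rewrite /rat_itv /rat_segment /= !in_itv /=.
  move=> /andP[rz zs]; apply/andP; split.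
    by apply: lt_le_trans rz; rewrite ltr_rat.
  by apply: le_lt_trans zs _; rewrite ltr_rat.
- by move=> a G Sa cG uG; apply: sel; split.
Qed.

End LevelFunction.

(** * The space *)

Section RealMetric.
Import GRing.Theory Num.Theory.
Local Open Scope ring_scope.
Variable R : realType.
Let mdistR (x y : R) : R := `|x - y|.
Let mdistR_ge0 x y : 0 <= mdistR x y. Proof. exact: normr_ge0. Qed.
Let mdistR_pos x y : mdistR x y = 0 -> x = y.
Proof. by move=> /normr0P; rewrite subr_eq0 => /eqP. Qed.
Let ballmdistR (x : R) e : ball x e = [set y | mdistR x y < e].
Proof. by rewrite -ball_normE. Qed.
Definition real_metric : metricType R :=
  HB.pack (R : Type) (PseudoMetric.on R)
   (PseudoMetric_isMetric.Build R R mdistR_ge0 mdistR_pos ballmdistR).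
End RealMetric.

Theorem theorem4p1 (R : realType)
    (d : Order.disp_t) (cplus : orderType d) (wo_cplus : well_ordered cplus)
    (cplusP : is_succ_cardinal cplus [set: R])
    (lambda mu : cplus) (mu_lim : limit_part lambda mu)
    (cf_mu : cofinality mu [set: nat]) :
  exists X : topologicalType,
    [/\ FLS X, separable X, special R X, [set: X] #= [set: R] &
        scattered_height X wo_cplus lambda].
Proof.
have [mu_limit [n /countable_addn_levels[mulam ctop]]] := mu_lim.
have [[C [Cmu Ccof] Cnat] _] := cf_mu.
pose L := initial_segment lambda.
pose e : L -> cplus := val.
have elam a : (e a < lambda)%O by exact: (svalP a).
have erange : range e = below lambda.
  apply/seteqP; split=> [_ [a _ <-]|a al]; first exact: elam.
  by exists (exist _ a al).
have einj : injective e by exact: val_inj.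
have wL : well_ordered L.
  move=> a; have [b bE] : exists b, e a = b by exists (e a).
  elim/(well_founded_ind wo_cplus): b a bE => b IH a ab.
  by constructor => a' a'a; apply: (IH (e a')) => //; rewrite -ab.
have cL : [set: L] #<= [set: set nat].
  apply: card_le_trans (card_real_le R); apply: card_le_trans (cplusP.2 lambda).
  by apply: (card_le_inj (f := e)) => [a _|a b _ _]; [exact: elam|exact: einj].
have [zero _ zero_min] :
    exists2 a : cplus, setT a & forall b, setT b -> (a <= b)%O.
  by apply: well_ordered_min wo_cplus _; exists mu.
have [c Cc c0] : exists2 c, C c & c <> zero.
  apply: contrapT => none; apply: infinite_nat.
  rewrite -(eq_finite_set Cnat); apply: sub_finite_set (finite_set1 zero).
  by move=> c Cc; apply: contrapT => c0; apply: none; exists c.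
have zlam : (zero < lambda)%O.
  by apply: le_lt_trans (zero_min c I) (lt_le_trans (Cmu _ Cc) mulam).
pose bot : L := exist _ zero zlam.
have bot_min a : (bot <= a)%O by exact: zero_min.
(* the levels that need countable fibres *)
pose S : set L := [set a | a = bot \/ (mu <= e a)%O].
have cS : countable S.
  apply: countable_setU; first exact: countable1.
  apply: (@sub_countable _ _ _ [set a | (mu <= a < lambda)%O]) => //.
  apply: (card_le_inj (f := e)) => [a /= ma|a b _ _]; last exact: einj.
  by rewrite ma elam.
have clam : (c < lambda)%O by exact: lt_le_trans (Cmu _ Cc) mulam.
(* the points of R that answer no request go to the level c, strictly between 0 and mu *)
have [|h [hS hdense hbern]] :=
    @bernstein_level_function R L S (exist _ c clam) cL cS.
  by case=> [/(congr1 e)//|]; rewrite leNgt (Cmu c Cc).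
pose M := real_metric R.
pose hM : M -> L := h.
have M0 : [set: M] !=set0 by exists (point : R).
have scM : @second_countable M by exact: second_countable_real.
have haus : hausdorff_space M by exact: Rhausdorff.
have hdenseM a (U : set M) : open U -> U !=set0 -> exists2 x, U x & hM x = a.
  exact: hdense.
exists (hmodification hM).
have scat : scattered (hmodification hM) by exact: hmodification_scattered.
split.
- split=> //.
  + exact: hmodification_hausdorff.
  + exact: hmodification_first_countable.
  apply: (hmodification_lindelof (C := e @^-1` C) scM).
  + apply: (@sub_countable _ _ _ C); last by rewrite (eq_countable Cnat).
    by apply: (card_le_inj (f := e)) => // a b _ _; exact: einj.
  + move=> a F Ca cF Fa; apply: contrapT => uF.
    have [abot|abot] := pselect (a = bot).
      apply: uF; suff -> : F = set0 by exact: countable0.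
      apply/seteqP; split=> // x /Fa.
      rewrite abot => /(le_lt_trans (bot_min _)).
      by rewrite ltxx.
    have [|x Fx hx] := hbern a F _ cF uF; last first.
      by move: (Fa _ Fx); rewrite /hM hx ltxx.
    by case=> //; rewrite leNgt (Cmu _ Ca).
  + (* mu is a limit: above any level below mu there is a level in C *)
    apply: sub_countable hS; apply: subset_card_le => x /= xtop; right.
    rewrite leNgt; apply/negP => xmu.
    apply: (mu_limit (e (h x))); split=> // b xb.
    rewrite leNgt; apply/negP => /Ccof[c' Cc' bc'].
    have c'lam : (c' < lambda)%O by exact: lt_le_trans (Cmu _ Cc') mulam.
    have := lt_le_trans (lt_le_trans xb bc') (xtop (exist _ c' c'lam) Cc').
    by rewrite ltxx.
- apply: (hmodification_separable hdenseM bot_min).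
  by apply: sub_countable hS; apply: subset_card_le => x; left.
- split=> //; exists M, d, L, hM; split=> //.
    exact: dense_fibres_height_function.
  by exists id, id; split=> // x; exact: cvg_id.
- exact: card_eqxx.
- exact: (hmodification_scattered_height hdenseM wo_cplus _ erange M0).
Qed.
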